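(* Any non-trivial 2-dimensional real commutative algebra is isomorphic to one and only one of the following commutative algebras, listed by their matrices of structure constants (different parameter values count as different members of the list): \[A_{1,r,c}(\alpha_1,\beta_1)=\begin{pmatrix}\alpha_1&0&0&1\\ \beta_1&1-\alpha_1&1-\alpha_1&0\end{pmatrix},\quad (\alpha_1,\beta_1)\in\mathbb{R}^2,\ \beta_1\ge 0,\] \[A_{2,r,c}(\alpha_1,\beta_1)=\begin{pmatrix}\alpha_1&0&0&-1\\ \beta_1&1-\alpha_1&1-\alpha_1&0\end{pmatrix},\quad (\alpha_1,\beta_1)\in\mathbb{R}^2,\ \beta_1\ge 0,\] \[A_{3,r,c}(\beta_1)=\begin{pmatrix}0&1&1&0\\ \beta_1&1&1&-1\end{pmatrix},\quad \beta_1\in\mathbb{R},\] \[A_{4,r,c}(\alpha_1)=\begin{pmatrix}\alpha_1&0&0&0\\ 0&1-\alpha_1&1-\alpha_1&0\end{pmatrix},\quad \alpha_1\in\mathbb{R},\] \[A_{5,r,c}=\begin{pmatrix}\frac23&0&0&0\\ 1&\frac13&\frac13&0\end{pmatrix},\quad A_{6,r,c}=\begin{pmatrix}0&1&1&0\\ 1&0&0&-1\end{pmatrix},\quad A_{7,r,c}=\begin{pmatrix}0&1&1&0\\ -1&0&0&-1\end{pmatrix},\] \[A_{8,r,c}=\begin{pmatrix}0&1&1&0\\ 0&0&0&-1\end{pmatrix},\quad A_{9,r,c}=\begin{pmatrix}0&0&0&0\\ 1&0&0&0\end{pmatrix}.\]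
   Context: A 2-dimensional real algebra is a 2-dimensional real vector space $\mathbb{A}$ with a bilinear multiplication $\cdot$ (not necessarily associative or unital); it is non-trivial if the multiplication is not identically zero, and commutative if $\mathbf{u}\cdot\mathbf{v}=\mathbf{v}\cdot\mathbf{u}$ for all $\mathbf{u},\mathbf{v}$. Given a basis $(e_1,e_2)$, its matrix of structure constants (MSC) is \[A=\begin{pmatrix}A^1_{1,1}&A^1_{1,2}&A^1_{2,1}&A^1_{2,2}\\ A^2_{1,1}&A^2_{1,2}&A^2_{2,1}&A^2_{2,2}\end{pmatrix},\qquad e_i\cdot e_j=A^1_{i,j}e_1+A^2_{i,j}e_2.\] Two algebras with MSCs $A$ and $B$ are isomorphic if and only if $B=gA(g^{-1}\otimes g^{-1})$ for some $g\in GL(2,\mathbb{R})$, where $\otimes$ is the Kronecker product. An algebra is identified with its MSC. *)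

(* Defs.v *)
From HB Require Import structures.
From mathcomp Require Export all_boot all_order all_algebra.
From mathcomp Require Export mxtens reals.

Set Implicit Arguments.
Unset Strict Implicit.
Unset Printing Implicit Defensive.

Import Order.TTheory GRing.Theory Num.Theory.

Local Open Scope ring_scope.

Section Algebras.

Variable R : realType.

Definition nontrivial_alg (V : vectType R) (mul : V -> V -> V) : Prop :=
  exists u v, mul u v <> 0.

Definition commutative_alg (V : vectType R) (mul : V -> V -> V) : Prop :=
  forall u v, mul u v = mul v u.

Definition isomorphic_alg (U V : vectType R)
    (mulU : U -> U -> U) (mulV : V -> V -> V) : Prop :=
  exists2 f : {linear U -> V},
    bijective f & forall x y, f (mulU x y) = mulV (f x) (f y).

(* Columns of a matrix of structure constants are ordered (1,1), (1,2),
   (2,1), (2,2), which is the order of [mxtens_index], so the product of the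
   coordinate columns u and v is A (u (x) v). *)
Definition msc_mul (A : 'M[R]_(2, 2 * 2)) (u v : 'cV[R]_2) : 'cV[R]_2 :=
  A *m (u *t v).

Lemma msc_mul_is_bilinear (A : 'M[R]_(2, 2 * 2)) :
  bilinear_for *:%R *:%R (msc_mul A).
Proof.
split=> w a x y; rewrite /= /msc_mul scalemxAr -mulmxDr; congr (_ *m _).
  by apply/matrixP=> i j; rewrite !mxE mulrDl mulrA.
by apply/matrixP=> i j; rewrite !mxE mulrDr mulrCA.
Qed.

HB.instance Definition _ (A : 'M[R]_(2, 2 * 2)) :=
  bilinear_isBilinear.Build R _ _ _ _ _ (msc_mul A) (msc_mul_is_bilinear A).

Lemma tens_colE (u v : 'cV[R]_2) (i j : 'I_2) (k : 'I_(1 * 1)) :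
  (u *t v) (mxtens_index (i, j)) k = u i 0 * v j 0.
Proof. by rewrite mxE mxtens_indexK !(ord1 (_ : 'I_1)). Qed.

Lemma msc_mul_delta (A : 'M[R]_(2, 2 * 2)) (i j : 'I_2) :
  msc_mul A (delta_mx i 0) (delta_mx j 0) =
  A 0 (mxtens_index (i, j)) *: delta_mx 0 0 +
  A 1 (mxtens_index (i, j)) *: delta_mx 1 0.
Proof.
apply/colP=> k; rewrite [LHS]mxE (bigD1 (mxtens_index (i, j))) //= big1 => [|l].
  rewrite addr0 tens_colE !mxE !eqxx !mulr1.
  have [->|->] : k = 0 \/ k = 1.
  - by case: k => [[|[|]] // ?]; [left|right]; apply: val_inj.
  - by rewrite !mulr1 mulr0 addr0.
  by rewrite !mulr1 mulr0 add0r.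
case: (mxtens_indexP l) => a b ne; rewrite tens_colE !mxE !eqxx !andbT -natrM mulnb.
suff -> : (a == i) && (b == j) = false by rewrite mulr0.
by apply: contraNF ne => /andP[/eqP-> /eqP->].
Qed.

Definition mk_msc (r1 r2 : seq R) : 'M[R]_(2, 2 * 2) :=
  \matrix_(i < 2, j < 2 * 2) nth 0 (if i == 0 then r1 else r2) j.

Inductive comm_form : Type :=
| A1rc of R & R
| A2rc of R & R
| A3rc of R
| A4rc of R
| A5rc
| A6rc
| A7rc
| A8rc
| A9rc.

Definition in_list (c : comm_form) : Prop :=
  match c with
  | A1rc a1 b1 | A2rc a1 b1 => 0 <= b1
  | _ => True
  end.

Definition msc_of (c : comm_form) : 'M[R]_(2, 2 * 2) :=
  match c with
  | A1rc a1 b1 => mk_msc [:: a1; 0; 0; 1]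
                         [:: b1; 1 - a1; 1 - a1; 0]
  | A2rc a1 b1 => mk_msc [:: a1; 0; 0; -1]
                         [:: b1; 1 - a1; 1 - a1; 0]
  | A3rc b1 => mk_msc [:: 0; 1; 1; 0]
                      [:: b1; 1; 1; -1]
  | A4rc a1 => mk_msc [:: a1; 0; 0; 0]
                      [:: 0; 1 - a1; 1 - a1; 0]
  | A5rc => mk_msc [:: 2 / 3; 0; 0; 0]
                   [:: 1; 1 / 3; 1 / 3; 0]
  | A6rc => mk_msc [:: 0; 1; 1; 0]
                   [:: 1; 0; 0; -1]
  | A7rc => mk_msc [:: 0; 1; 1; 0]
                   [:: -1; 0; 0; -1]
  | A8rc => mk_msc [:: 0; 1; 1; 0]
                   [:: 0; 0; 0; -1]
  | A9rc => mk_msc [:: 0; 0; 0; 0]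
                   [:: 1; 0; 0; 0]
  end.

Lemma msc_of_commutative (c : comm_form) : commutative_alg (msc_mul (msc_of c)).
Proof.
have swap (k a b : 'I_2) :
    msc_of c k (mxtens_index (a, b)) = msc_of c k (mxtens_index (b, a)).
  by case: c k a b => [? ?|? ?|?|?|||||] [[|[|]] // ?] [[|[|]] // ?]
    [[|[|]] // ?]; rewrite !mxE.
have bij : {on predT, bijective (@mxtens_index 2 2)}.
  exists (@mxtens_unindex 2 2) => x _; [exact: mxtens_indexK|exact: mxtens_unindexK].
have mulE x y k : msc_mul (msc_of c) x y k 0 =
    \sum_i \sum_j msc_of c k (mxtens_index (i, j)) * (x i 0 * y j 0).
  rewrite mxE (reindex _ bij) pair_bigA; apply: eq_bigr => -[i j] _.
  by rewrite tens_colE.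
move=> u v; apply/colP=> k; rewrite !mulE exchange_big; apply: eq_bigr => i _.
by apply: eq_bigr => j _; rewrite swap [u _ _ * _]mulrC.
Qed.

End Algebras.

(* Main.v *)
(* The trace of left multiplication, tau(u) = tr(L_u), is an invariant linear
   form.  If tau <> 0, choose a basis with tau(e1) = 1 and tau(e2) = 0; the only
   remaining freedom is e1 -> e1 + r e2, e2 -> s e2, and normalising e2 e2 first,
   then e1 e2, then e1 e1 gives A1-A5, without any freedom left except the sign
   of s in A1 and A2.  If tau = 0, the algebra is determined by the binary cubic
   form det(u, u u), which has a real root; taking e2 on this root line gives
   A6-A9.  Two algebras of the list realised in the same space are related by a
   change of basis, so uniqueness is a statement about structure constants. *)

From HB Require Import structures.
Require Import Defs.
From mathcomp Require Import all_boot all_order all_algebra.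
From mathcomp Require Import reals.
From mathcomp Require Import polyrcf ring lra.

Local Open Scope ring_scope.
Import Order.TTheory GRing.Theory Num.Theory.

Set Implicit Arguments.
Unset Strict Implicit.
Unset Printing Implicit Defensive.

(** * Coordinates in a plane *)

Section Combinations.

Variables (R : realType) (V : vectType R).
Implicit Types (e f : V) (p q r s x y : R).

Definition comb e1 e2 x y : V := x *: e1 + y *: e2.

Lemma comb_comb e1 e2 p q r s x y :
  comb (comb e1 e2 p r) (comb e1 e2 q s) x y =
  comb e1 e2 (x * p + y * q) (x * r + y * s).
Proof. by rewrite /comb !scalerDr !scalerA !scalerDl addrACA. Qed.

Lemma combD e1 e2 x y x' y' :
  comb e1 e2 x y + comb e1 e2 x' y' = comb e1 e2 (x + x') (y + y').
Proof. by rewrite /comb !scalerDl addrACA. Qed.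

Lemma combZ e1 e2 p x y : p *: comb e1 e2 x y = comb e1 e2 (p * x) (p * y).
Proof. by rewrite /comb scalerDr !scalerA. Qed.

Lemma linear_comb (W : vectType R) (f : {linear V -> W}) e1 e2 x y :
  f (comb e1 e2 x y) = x *: f e1 + y *: f e2.
Proof. by rewrite /comb linearD !linearZ. Qed.

Lemma free2P e1 e2 :
  free [:: e1; e2] <-> (forall x y, comb e1 e2 x y = 0 -> x = 0 /\ y = 0).
Proof.
split=> [fr x y xy0|H].
  have /freeP/(_ (fun i => if i == 0 then x else y)) :
    free [tuple e1; e2] by [].
  rewrite !big_ord_recl big_ord0 /= addr0 => /(_ xy0) k0.
  by split; [exact: (k0 0) | exact: (k0 1)].
apply/(@freeP _ _ _ [tuple e1; e2]) => k.
rewrite !big_ord_recl big_ord0 /= addr0 => /H[k0 k1] [[|[|//]] i2].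
  by rewrite -k0; congr k; apply: val_inj.
by rewrite -k1; congr k; apply: val_inj.
Qed.

Lemma comb_inj e1 e2 x y x' y' : free [:: e1; e2] ->
  comb e1 e2 x y = comb e1 e2 x' y' -> x = x' /\ y = y'.
Proof.
move=> /free2P fr E.
have [] : x - x' = 0 /\ y - y' = 0.
  by apply: fr; rewrite /comb !scalerBl addrACA -opprD; apply/eqP; rewrite subr_eq0; apply/eqP.
by move=> /eqP; rewrite subr_eq0 => /eqP-> /eqP; rewrite subr_eq0 => /eqP->.
Qed.

Lemma free_comb e1 e2 p q r s : free [:: e1; e2] -> p * s - q * r != 0 ->
  free [:: comb e1 e2 p r; comb e1 e2 q s].
Proof.
move=> /free2P fr d0; apply/free2P => x y; rewrite comb_comb => /fr[E1 E2].
(* Cramer's rule, with the nonzero determinant as common factor. *)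
split; apply: (mulfI d0); rewrite mulr0.
  have : s * (x * p + y * q) - q * (x * r + y * s) = s * 0 - q * 0.
    by rewrite E1 E2.
  by lra.
have : p * (x * r + y * s) - r * (x * p + y * q) = p * 0 - r * 0.
  by rewrite E1 E2.
by lra.
Qed.

Hypothesis dimV : \dim {:V} = 2%N.

Lemma comb_span e1 e2 v : free [:: e1; e2] -> exists x y, v = comb e1 e2 x y.
Proof.
move=> fr; have bE : basis_of fullv [tuple e1; e2].
  by rewrite basisEfree fr subvf /= dimV.
rewrite (coord_basis bE (memvf v)) !big_ord_recl big_ord0 addr0.
by do 2!eexists.
Qed.

Lemma free2_ex : exists e1 e2 : V, free [:: e1; e2].
Proof.
have := basis_free (vbasisP {:V}).
have : size (vbasis {:V}) = 2%N by rewrite size_tuple.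
case: (tval _) => [|e1 [|e2 []]] // _ fr.
by exists e1, e2.
Qed.

End Combinations.

(* [k] and [l] are the first and second rows of the matrix of structure
   constants, without the redundant column (2,1). *)
Record comm_sc (R : realType) :=
  CommSC { k11 : R; k12 : R; k22 : R; l11 : R; l12 : R; l22 : R }.

(* [p q r s] are the entries of the matrix with columns [(p, r)] and [(q, s)],
   the coordinates of the new basis in the old one. *)
Definition basis_change (R : realType) (T T' : comm_sc R) (p q r s : R) : Prop :=
  [/\ k11 T' * p + l11 T' * q
        = p ^+ 2 * k11 T + 2 * p * r * k12 T + r ^+ 2 * k22 T /\
      k11 T' * r + l11 T' * s
        = p ^+ 2 * l11 T + 2 * p * r * l12 T + r ^+ 2 * l22 T,
      k12 T' * p + l12 T' * q
        = p * q * k11 T + (p * s + r * q) * k12 T + r * s * k22 T /\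
      k12 T' * r + l12 T' * s
        = p * q * l11 T + (p * s + r * q) * l12 T + r * s * l22 T
    & k22 T' * p + l22 T' * q
        = q ^+ 2 * k11 T + 2 * q * s * k12 T + s ^+ 2 * k22 T /\
      k22 T' * r + l22 T' * s
        = q ^+ 2 * l11 T + 2 * q * s * l12 T + s ^+ 2 * l22 T].

(** * Multiplication tables under a change of basis *)

Section Tables.

Variables (R : realType) (V : vectType R) (mul : {bilinear V -> V -> V}).
Hypothesis mulC : commutative_alg mul.
Implicit Types (T : comm_sc R) (e f : V) (p q r s : R).

Definition has_table e1 e2 T :=
  [/\ mul e1 e1 = comb e1 e2 (k11 T) (l11 T),
      mul e1 e2 = comb e1 e2 (k12 T) (l12 T)
    & mul e2 e2 = comb e1 e2 (k22 T) (l22 T)].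

Definition realizes T := exists e1 e2, free [:: e1; e2] /\ has_table e1 e2 T.

Lemma mul_comb e1 e2 T p q r s : has_table e1 e2 T ->
  mul (comb e1 e2 p r) (comb e1 e2 q s) =
  comb e1 e2 (p * q * k11 T + (p * s + r * q) * k12 T + r * s * k22 T)
             (p * q * l11 T + (p * s + r * q) * l12 T + r * s * l22 T).
Proof.
case=> E11 E12 E22; rewrite {1 2}/comb.
rewrite linearDl !linearDr /= !linearZl_LR !linearZr_LR /=.
rewrite (mulC e2 e1) E11 E12 E22 !combZ !combD.
by congr comb; ring.
Qed.

Lemma basis_changeP e1 e2 T T' p q r s : free [:: e1; e2] ->
  has_table e1 e2 T ->
  has_table (comb e1 e2 p r) (comb e1 e2 q s) T' <-> basis_change T T' p q r s.
Proof.
move=> fr tT; rewrite /has_table !(mul_comb _ _ _ _ tT) !comb_comb.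
split=> [[]|[[E1 E2] [E3 E4] [E5 E6]]].
  move=> /(comb_inj fr)[E1 E2] /(comb_inj fr)[E3 E4] /(comb_inj fr)[E5 E6].
  by split; split; lra.
by split; congr comb; lra.
Qed.

Lemma realizes_change T T' p q r s : realizes T -> p * s - q * r != 0 ->
  basis_change T T' p q r s -> realizes T'.
Proof.
move=> [e1 [e2 [fr tT]]] d0 bc; exists (comb e1 e2 p r), (comb e1 e2 q s).
by split; [exact: free_comb | exact/(basis_changeP _ _ _ _ _ fr tT)].
Qed.

Hypothesis dimV : \dim {:V} = 2%N.

Lemma realizes_basis_change T T' : realizes T -> realizes T' ->
  exists p q r s, p * s - q * r != 0 /\ basis_change T T' p q r s.
Proof.
move=> [e1 [e2 [fr tT]]] [f1 [f2 [fr' tT']]].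
have [p [r Ef1]] := comb_span dimV f1 fr.
have [q [s Ef2]] := comb_span dimV f2 fr.
exists p, q, r, s; split; last first.
  by apply/(basis_changeP _ _ _ _ _ fr tT); rewrite -Ef1 -Ef2.
apply/eqP => d0.
have /free2P fr2 := fr'.
have inv x y : x * p + y * q = 0 -> x * r + y * s = 0 -> x = 0 /\ y = 0.
  by move=> E1 E2; apply: fr2; rewrite Ef1 Ef2 comb_comb E1 E2 /comb !scale0r addr0.
(* With determinant zero, the rows of the adjugate are linear relations between [f1] and [f2], so
   all four entries vanish. *)
have [||s0 r0] := inv s (- r); [lra|lra|].
have [||q0 p0] := inv q (- p); [lra|lra|].
by have [||/eqP] := inv 1 0; [lra|lra|rewrite oner_eq0].
Qed.

Lemma has_table_ex e1 e2 : free [:: e1; e2] -> exists T, has_table e1 e2 T.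
Proof.
move=> fr.
have [a [b E11]] := comb_span dimV (mul e1 e1) fr.
have [c [d E12]] := comb_span dimV (mul e1 e2) fr.
have [g [h E22]] := comb_span dimV (mul e2 e2) fr.
by exists (CommSC a c g b d h).
Qed.

Lemma realizes_ex : exists T, realizes T.
Proof.
have [e1 [e2 fr]] := free2_ex dimV; have [T tT] := has_table_ex fr.
by exists T, e1, e2.
Qed.

(** For a basis chosen for its effect on the traces or on a single entry, when the rest of the new
    table need not be computed. *)
Lemma change_ex T p q r s : realizes T -> p * s - q * r != 0 ->
  exists T', realizes T' /\ basis_change T T' p q r s.
Proof.
move=> [e1 [e2 [fr tT]]] d0.
have fr' := free_comb fr d0; have [T' tT'] := has_table_ex fr'.
exists T'; split; last exact/(basis_changeP _ _ _ _ _ fr tT).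
by exists (comb e1 e2 p r), (comb e1 e2 q s).
Qed.

Lemma realizes_zero : nontrivial_alg mul -> ~ realizes (CommSC 0 0 0 0 0 0).
Proof.
move=> [u [v uv]] [e1 [e2 [fr tT]]]; apply: uv.
have [x [y ->]] := comb_span dimV u fr.
have [x' [y' ->]] := comb_span dimV v fr.
by rewrite (mul_comb _ _ _ _ tT) /= !mulr0 !addr0 /comb !scale0r addr0.
Qed.

End Tables.

Definition sc_of (R : realType) (c : comm_form R) : comm_sc R :=
  match c with
  | A1rc a b => CommSC a 0 1 b (1 - a) 0
  | A2rc a b => CommSC a 0 (-1) b (1 - a) 0
  | A3rc b => CommSC 0 1 0 b 1 (-1)
  | A4rc a => CommSC a 0 0 0 (1 - a) 0
  | A5rc => CommSC (2 / 3) 0 0 1 (1 / 3) 0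
  | A6rc => CommSC 0 1 0 1 0 (-1)
  | A7rc => CommSC 0 1 0 (-1) 0 (-1)
  | A8rc => CommSC 0 1 0 0 0 (-1)
  | A9rc => CommSC 0 0 0 1 0 0
  end.

(** * Isomorphisms as bases with a prescribed table *)

Section Isomorphism.

Variables (R : realType) (V : vectType R) (mul : {bilinear V -> V -> V}).
Hypothesis mulC : commutative_alg mul.
Hypothesis dimV : \dim {:V} = 2%N.

Lemma cV2_comb (u : 'cV[R]_2) :
  u = comb (delta_mx 0 0) (delta_mx 1 0) (u 0 0) (u 1 0).
Proof.
apply/colP => -[[|[|//]] i2]; rewrite !mxE /= ?mulr1 ?mulr0 ?addr0 ?add0r.
  by congr (u _ _); apply: val_inj.
by congr (u _ _); apply: val_inj.
Qed.

Lemma msc_of_table (c : comm_form R) :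
  has_table (msc_mul (msc_of c)) (delta_mx 0 0) (delta_mx 1 0) (sc_of c).
Proof.
split; apply: (etrans (msc_mul_delta _ _ _)); rewrite /comb;
  by case: c => [a b|a b|b|a|||||]; rewrite !mxE.
Qed.

Lemma isomorphic_realizes (c : comm_form R) :
  isomorphic_alg mul (msc_mul (msc_of c)) <-> realizes mul (sc_of c).
Proof.
have cC := msc_of_commutative c; have [t11 t12 t22] := msc_of_table c.
split=> [[f [g fK gK] fM]|[e1 [e2 [fr [E11 E12 E22]]]]].
  have fI := can_inj fK.
  exists (g (delta_mx 0 0)), (g (delta_mx 1 0)); split.
    apply/free2P => x y /(congr1 f); rewrite linear_comb !gK linear0 => /colP E.
    have := E 0; have := E 1.
    by rewrite !mxE /= !mulr1 !mulr0 addr0 add0r.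
  by split; apply: fI; rewrite fM !gK linear_comb !gK.
have bE : basis_of fullv [tuple e1; e2].
  by rewrite basisEfree fr subvf /= dimV.
pose h v : 'cV[R]_2 := \col_i coord [tuple e1; e2] i v.
have hlin : linear h by move=> a u v; apply/colP => i; rewrite !mxE linearP.
pose f : {linear V -> 'cV[R]_2} := HB.pack h (GRing.isLinear.Build _ _ _ _ h hlin).
have fE v : f v = h v by [].
pose g (u : 'cV[R]_2) : V := comb e1 e2 (u 0 0) (u 1 0).
have fK : cancel f g.
  move=> v; rewrite [RHS](coord_basis bE (memvf v)) !big_ord_recl big_ord0 addr0.
  rewrite /g fE !mxE /comb; congr (_ + coord _ _ v *: _); exact: val_inj.
have gK : cancel g f.
  move=> u; have [E0 E1] := comb_inj fr (fK (g u)).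
  by rewrite [LHS]cV2_comb [RHS]cV2_comb E0 E1.
have gE x y : g (comb (delta_mx 0 0) (delta_mx 1 0) x y) = comb e1 e2 x y.
  by rewrite /g !mxE /= !mulr1 !mulr0 addr0 add0r.
(* Multiplicativity is checked on the inverse [g], an explicit combination, and carried to [f] by
   cancellation. *)
have gM u v : g (msc_mul (msc_of c) u v) = mul (g u) (g v).
  rewrite {1}(cV2_comb u) {1}(cV2_comb v).
  rewrite (mul_comb cC _ _ _ _ (And3 t11 t12 t22)) gE.
  by rewrite (mul_comb mulC _ _ _ _ (And3 E11 E12 E22)).
exists f; first by exists g.
by move=> x y; rewrite -[RHS]gK gM !fK.
Qed.

End Isomorphism.

(** * The trace form and real roots of cubics *)

Section Invariants.

Variable R : realType.
Implicit Types (T : comm_sc R) (p q r s : R).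

Lemma trace_change T T' p q r s : p * s - q * r != 0 ->
  basis_change T T' p q r s ->
  k11 T' + l12 T' = p * (k11 T + l12 T) + r * (k12 T + l22 T) /\
  k12 T' + l22 T' = q * (k11 T + l12 T) + s * (k12 T + l22 T).
Proof.
move=> d0 [[E1 E2] [E3 E4] [E5 E6]].
case: T T' E1 E2 E3 E4 E5 E6 => a b c x y z [a' b' c' x' y' z'] /=.
move=> E1 E2 E3 E4 E5 E6.
split; apply: (mulfI d0).
  (* Cramer's rule: the first two equations isolate [a'] and the last two [y'], each times the
     determinant. *)
  have := congr2 +%R (congr2 +%R (congr1 ( *%R s) E1) (congr1 ( *%R (- q)) E2))
                  (congr2 +%R (congr1 ( *%R (- r)) E3) (congr1 ( *%R p) E4)).
  by move=> E; lra.
have := congr2 +%R (congr2 +%R (congr1 ( *%R s) E3) (congr1 ( *%R (- q)) E4))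
                  (congr2 +%R (congr1 ( *%R (- r)) E5) (congr1 ( *%R p) E6)).
by move=> E; lra.
Qed.

Lemma cubic_root (a b c d : R) : a != 0 ->
  exists x, a * x ^+ 3 + b * x ^+ 2 + c * x + d = 0.
Proof.
move=> a0; have s4 : size (Poly [:: d; c; b; a]) = 4%N by rewrite (@PolyK _ 0).
have [|x /rootP] := @odd_poly_root R (Poly [:: d; c; b; a]); first by rewrite s4.
by rewrite horner_Poly /= => E; exists x; lra.
Qed.

End Invariants.

(** * Existence of a normal form *)

Section NormalForms.

Variables (R : realType) (V : vectType R) (mul : {bilinear V -> V -> V}).
Hypothesis mulC : commutative_alg mul.
Hypothesis dimV : \dim {:V} = 2%N.
Implicit Types a b d x y p q r s t : R.

Local Notation listed := (exists c, in_list c /\ realizes mul (sc_of c)).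

(** Some structure constants scale by squares, so over the reals only their sign survives. This
    separates A1 from A2 and A6 from A7. *)
Lemma sqr_normalizer d : d != 0 ->
  exists t, t != 0 /\ t ^+ 2 * d = Num.sg d.
Proof.
move=> d0; have n0 : 0 < `|d| by rewrite normr_gt0.
exists (Num.sqrt `|d|)^-1; split; first by rewrite invr_eq0 sqrtr_eq0 -ltNge.
by rewrite exprVn sqr_sqrtr ?ltW // {2}[d]numEsg mulrCA mulVf ?mulr1 // gt_eqF.
Qed.

Lemma listed_trace1 a b d x :
  realizes mul (CommSC a b d x (1 - a) (- b)) -> listed.
Proof.
move=> rT; have [d0|d0] := eqVneq d 0; last first.
  (* This [r] removes the e1-coefficient of e1 e2; [al] and [y] are then the coefficients of e1 e1
     before e2 is rescaled. *)
  pose r := - b / d; pose al := a + r * b.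
  pose y := x + 2 * r * (1 - a) - r ^+ 2 * b - al * r.
  have [t [t0 [td ty]]] :
      exists t, t != 0 /\ t ^+ 2 * d = Num.sg d /\ 0 <= y / t.
    have [t [t0 td]] := sqr_normalizer d0.
    (* Only [t ^+ 2] is prescribed; the sign of [t] is free. *)
    have [yt|yt] := leP 0 (y / t); first by exists t.
    exists (- t); rewrite oppr_eq0 sqrrN; do 2!split=> //.
    by rewrite invrN mulrN oppr_ge0 ltW.
  have rT' : realizes mul (CommSC al 0 (Num.sg d) (y / t) (1 - al) 0).
    apply: (realizes_change mulC (p := 1) (q := 0) (r := r) (s := t) rT).
      by rewrite mul1r mul0r subr0.
    by rewrite -td; split; split; rewrite /= /y /al /r; field; rewrite ?d0 ?t0.
  case: sgrP d0 rT' => // _ _ rT'.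
  - by exists (A1rc al (y / t)).
  - by exists (A2rc al (y / t)).
have [b0|b0] := eqVneq b 0; last first.
  (* Replacing e1 by e1 + r e2 turns [a] into [a + 2 * r * b], which this [r] cancels. *)
  pose r := - a / (2 * b).
  exists (A3rc ((x + 2 * r * (1 - a) - r ^+ 2 * b) * b)); split=> //.
  apply: (realizes_change mulC (p := 1) (q := 0) (r := r) (s := b^-1) rT).
    by rewrite mul1r mul0r subr0 invr_eq0.
  by rewrite d0; split; split; rewrite /= /r; field; rewrite ?b0.
(* The shift by [r] now changes [x] into [x - (3 * a - 2) * r], so [x] can be removed unless [a] is
   2/3; this exception yields A5. *)
subst b d; have [a23|a23] := eqVneq (3 * a - 2) 0; last first.
  exists (A4rc a); split=> //.
  apply: (realizes_change mulC (p := 1) (q := 0) (r := x / (3 * a - 2))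
                          (s := 1) rT).
    by rewrite mul1r mul0r subr0 oner_neq0.
  by split; split=> /=; field.
have aE : a = 2 / 3 by lra.
have [x0|x0] := eqVneq x 0.
  by exists (A4rc a); split=> //; move: rT; rewrite x0 oppr0.
exists (A5rc R); split=> //.
apply: (realizes_change mulC (p := 1) (q := 0) (r := 0) (s := x) rT).
  by rewrite mul1r mul0r subr0.
by rewrite aE; split; split=> /=; field.
Qed.

Lemma listed_trace0_root a b x : nontrivial_alg mul ->
  realizes mul (CommSC a b 0 x (- a) (- b)) -> listed.
Proof.
move=> nt rT; have [b0|b0] := eqVneq b 0; last first.
  pose r := - a / (2 * b); pose w := b * (x - 2 * r * a - r ^+ 2 * b).
  have rT' p : p != 0 -> realizes mul (CommSC 0 1 0 (p ^+ 2 * w) 0 (-1)).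
    move=> p0.
    apply: (realizes_change mulC (p := p) (q := 0) (r := p * r) (s := b^-1) rT).
      by rewrite mul0r subr0 mulf_neq0 ?invr_eq0.
    by split; split; rewrite /= /w /r; field; rewrite ?b0 ?p0.
  have [w0|w0] := eqVneq w 0.
    by exists (A8rc R); split=> //; have := rT' 1 (oner_neq0 _); rewrite w0 mulr0.
  have [p [p0 pw]] := sqr_normalizer w0; have {rT'} := rT' p p0.
  rewrite pw; case: sgrP w0 => // _ _ rT'.
  - by exists (A6rc R).
  - by exists (A7rc R).
subst b; have [a0|a0] := eqVneq a 0; last first.
  (* The cubic det(u, u u) is now [q ^+ 2 * (x * q - 3 * a * s)]. The double root line e2 becomes
     the first basis line, the simple one the second. *)
  exists (A8rc R); split=> //.
  apply: (realizes_change mulC (p := 0) (q := - a^-1) (r := 1)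
                          (s := - x / (3 * a ^+ 2)) rT).
    by rewrite mul0r mulr1 sub0r opprK invr_eq0.
  by split; split=> /=; field.
subst a; have [x0|x0] := eqVneq x 0.
  by case: (realizes_zero mulC dimV nt); move: rT; rewrite x0 oppr0.
exists (A9rc R); split=> //.
apply: (realizes_change mulC (p := 1) (q := 0) (r := 0) (s := x) rT).
  by rewrite mul1r mul0r subr0.
by split; split=> /=; field.
Qed.

Lemma sqr_sum_neq0 x y : ~~ ((x == 0) && (y == 0)) -> x ^+ 2 + y ^+ 2 != 0.
Proof. by rewrite paddr_eq0 ?sqr_ge0 // !sqrf_eq0. Qed.

(* The cubic below is det(u, u u) at u = q e1 + s e2; its vanishing makes u u
   proportional to u, so that u can serve as the second basis vector. *)
Lemma listed_trace0 a b d x : nontrivial_alg mul ->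
  realizes mul (CommSC a b d x (- a) (- b)) -> listed.
Proof.
move=> nt rT.
have [q [s [/sqr_sum_neq0 n0 qs]]] : exists q s, ~~ ((q == 0) && (s == 0)) /\
    x * q ^+ 3 - 3 * a * q ^+ 2 * s - 3 * b * q * s ^+ 2 - d * s ^+ 3 = 0.
  have [x0|x0] := eqVneq x 0.
    by exists 1, 0; rewrite oner_eq0 x0; split=> //; ring.
  have [q Eq] := cubic_root (- 3 * a) (- 3 * b) (- d) x0.
  by exists q, 1; rewrite oner_eq0 andbF; split=> //; lra.
(* The root (q, s) becomes e2 and is completed by its orthogonal (s, -q). *)
have D0 : s * s - q * (- q) != 0 by rewrite mulrN opprK -!expr2 addrC.
have [[a' b' d' x' y' z'] [rT' bc]] := change_ex mulC dimV rT D0.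
have [] := trace_change D0 bc; rewrite /= => E1 E2.
case: bc => _ _ [/= E5 E6].
(* By Cramer's rule the determinant times [d'] is minus the cubic at (q, s). *)
have d'0 : d' = 0.
  apply: (mulfI D0).
  have := congr2 +%R (congr1 ( *%R s) E5) (congr1 ( *%R (- q)) E6).
  by move=> E; lra.
apply: (listed_trace0_root (a := a') (b := b') (x := x') nt).
have -> : - a' = y' by lra.
have -> : - b' = z' by lra.
by rewrite -d'0.
Qed.

Lemma listed_ex : nontrivial_alg mul -> listed.
Proof.
move=> nt; have [[a b d x y z] rT] := realizes_ex mul dimV.
pose t1 := a + y; pose t2 := b + z.
have [|/sqr_sum_neq0 n0] := boolP ((t1 == 0) && (t2 == 0)).
  move=> /andP[/eqP t10 /eqP t20].
  apply: (listed_trace0 (a := a) (b := b) (d := d) (x := x) nt).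
  have -> : - a = y by rewrite /t1 in t10; lra.
  by have -> : - b = z by rewrite /t2 in t20; lra.
(* The new e1 is (t1, t2) / n, of trace 1, and the new e2 is (-t2, t1), of trace 0. *)
pose n := t1 ^+ 2 + t2 ^+ 2.
have D1 : t1 / n * t1 - (- t2) * (t2 / n) = 1 by rewrite /n; field.
have D0 : t1 / n * t1 - (- t2) * (t2 / n) != 0 by rewrite D1 oner_neq0.
have [[a' b' d' x' y' z'] [rT' bc]] := change_ex mulC dimV rT D0.
have [] := trace_change D0 bc; rewrite /= -/t1 -/t2 => E1 E2.
apply: (listed_trace1 (a := a') (b := b') (d := d') (x := x')).
have -> : 1 - a' = y' by lra.
by have -> : - b' = z' by lra.
Qed.

End NormalForms.

(** * Uniqueness of the normal form *)

Section Uniqueness.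

Variable R : realType.
Implicit Types (T : comm_sc R) (p q r s b : R).

(* The traces of the left multiplications by e1 and e2. *)
Definition tr1 T := k11 T + l12 T.
Definition tr2 T := k12 T + l22 T.

(** Invariance of the trace form forces [p = 1] and [q = 0]. *)
Lemma basis_change_trace1 T T' p q r s : p * s - q * r != 0 ->
  basis_change T T' p q r s ->
  tr1 T = 1 -> tr2 T = 0 -> tr1 T' = 1 -> tr2 T' = 0 ->
  [/\ s != 0, k22 T' = s ^+ 2 * k22 T, k12 T' = s * (k12 T + r * k22 T),
      k11 T' = k11 T + 2 * r * k12 T + r ^+ 2 * k22 T
    & l11 T' * s = l11 T + 2 * r * l12 T + r ^+ 2 * l22 T - k11 T' * r].
Proof.
move=> D0 bc; have [] := trace_change D0 bc; rewrite -!/(tr1 _) -!/(tr2 _).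
move=> E1 E2 t1 t2 t1' t2'; rewrite t1 t2 t1' in E1; rewrite t1 t2 t2' in E2.
have p1 : p = 1 by lra.
have q0 : q = 0 by lra.
subst p q; move: D0; rewrite mul1r mul0r subr0 => s0.
case: bc => -[E11 E12] [E21 E22] [E31 E32].
by split; [|lra..].
Qed.

Lemma sqr1_ge0_inj s b b' : 0 <= b -> 0 <= b' -> s ^+ 2 = 1 -> b' * s = b -> b = b'.
Proof.
move=> b0 b0' /eqP; rewrite sqrf_eq1 => /orP[] /eqP-> E; first by lra.
by lra.
Qed.

Lemma tr2_sc_of (c : comm_form R) : tr2 (sc_of c) = 0.
Proof. by case: c => [a b|a b|b|a|||||]; rewrite /tr2 /= ?subrr ?addr0. Qed.

Lemma tr1_sc_of (c : comm_form R) : tr1 (sc_of c) =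
  match c with A6rc | A7rc | A8rc | A9rc => 0 | _ => 1 end.
Proof. by case: c => [a b|a b|b|a|||||]; rewrite /tr1 /=; lra. Qed.

Lemma sc_of_inj_trace1 (c c' : comm_form R) p q r s :
  in_list c -> in_list c' -> p * s - q * r != 0 ->
  basis_change (sc_of c) (sc_of c') p q r s ->
  tr1 (sc_of c) = 1 -> tr1 (sc_of c') = 1 -> c = c'.
Proof.
move=> inc inc' D0 bc t1 t1'.
have [s0 E1 E2 E3 E4] :=
  basis_change_trace1 D0 bc t1 (tr2_sc_of c) t1' (tr2_sc_of c').
have s2 : 0 < s ^+ 2 by rewrite exprn_even_gt0.
(* In this form [s != 0] is usable by [lra]. *)
have contra : s = 0 -> False by apply/eqP.
rewrite !tr1_sc_of in t1 t1'.
(* [k22] scales by a positive square and, where it vanishes, [k12] scales by [s]. Among distinct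
   forms of trace 1 only A4 against A5 survives this. *)
case: c c' inc inc' t1 t1' E1 E2 E3 E4 {D0 bc} =>
  [a b|a b|b|a|||||] [a' b'|a' b'|b'|a'|||||] //= b0 b0' t1 t1' E1 E2 E3 E4;
  try by exfalso; lra.
- have r0 : r = 0 by apply: (mulfI s0); lra.
  subst r; have s1 : s ^+ 2 = 1 by lra.
  by rewrite (@sqr1_ge0_inj s b b') //; [congr A1rc|]; lra.
- have r0 : r = 0 by apply: (mulfI s0); lra.
  subst r; have s1 : s ^+ 2 = 1 by lra.
  by rewrite (@sqr1_ge0_inj s b b') //; [congr A2rc|]; lra.
- have r0 : r = 0 by lra.
  have s1 : s = 1 by lra.
  by subst r s; congr A3rc; lra.
- by congr A4rc; lra.
(* At 2/3 the shift [r] drops out of the law for [l11], so a zero [l11] stays zero. *)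
- have aE : a = 2 / 3 by lra.
  by case: contra; subst a; lra.
have aE : a' = 2 / 3 by lra.
by exfalso; subst a'; lra.
Qed.

(* 2 (b x ^+ 2 + y ^+ 2) is the invariant quadratic form tr(L_u ^+ 2), whose
   signature determines the sign of b. *)
Lemma basis_change_sg b b' p q r s : p * s - q * r != 0 ->
  basis_change (CommSC 0 1 0 b 0 (-1)) (CommSC 0 1 0 b' 0 (-1)) p q r s ->
  Num.sg b = Num.sg b'.
Proof.
move=> D0 [/= [E1 E2] [E3 E4] [E5 E6]].
have [q0|q0] := eqVneq q 0.
  subst q; move: D0; rewrite mul0r subr0 mulf_eq0 negb_or => /andP[p0 s0].
  have s1 : s = 1 by apply: (mulfI s0); lra.
  have r0 : r = 0 by apply: (mulfI p0); lra.
  subst r s; have -> : b' = p ^+ 2 * b by lra.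
  by rewrite sgrM (@gtr0_sg _ (p ^+ 2)) ?mul1r // exprn_even_gt0.
(* The new e2 lies on another root line of the cubic [q * (b * q ^+ 2 - 3 * s ^+ 2)]; as [s] is
   nonzero, [b] is positive, and so is [b']. *)
have s12 : s = - (1 / 2) by apply: (mulfI q0); lra.
subst s; have q2 : 0 < q ^+ 2 by rewrite exprn_even_gt0.
have p0 : p != 0.
  by apply: contra_neq D0 => p0; subst p; have r0 : r = 0; [lra | rewrite r0; ring].
have p2 : 0 < p ^+ 2 by rewrite exprn_even_gt0.
have bq : q ^+ 2 * b = 3 / 4 by lra.
have b'q : q ^+ 2 * b' = 3 * p ^+ 2.
  have rq : r * q = 3 / 2 * p by lra.
  have : (b' * q) * q = 2 * p * (r * q) by rewrite mulrA; congr (_ * _); lra.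
  by rewrite rq => E; lra.
by rewrite !gtr0_sg // -(pmulr_rgt0 _ q2) ?bq ?b'q; lra.
Qed.

(** The new basis has f1 f2 = f1, but products in A9 are multiples of e2, which annihilates the
    algebra; so f1 = 0. *)
Lemma basis_change_A9_l b p q r s : p * s - q * r != 0 ->
  ~ basis_change (sc_of (A9rc R)) (CommSC 0 1 0 b 0 (-1)) p q r s.
Proof.
move=> D0 [/= [E1 E2] [E3 E4] [E5 E6]].
have p0 : p = 0 by lra.
subst p; have r0 : r = 0 by lra.
by move/eqP: D0; apply; rewrite r0; ring.
Qed.

(** The second basis vector of A9 annihilates the algebra; in A6 to A8 no nonzero vector does. *)
Lemma basis_change_A9_r b p q r s : p * s - q * r != 0 ->
  ~ basis_change (CommSC 0 1 0 b 0 (-1)) (sc_of (A9rc R)) p q r s.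
Proof.
move=> D0 [/= [E1 E2] [E3 E4] [E5 E6]].
have q0 : q = 0.
  have [//|q0] := eqVneq q 0; have s0 : s = 0 by apply: (mulfI q0); lra.
  subst s; have r0 : r = 0 by apply: (mulfI q0); lra.
  by subst r; move/eqP: D0; case; ring.
subst q; have s0 : s = 0 by apply/eqP; rewrite -sqrf_eq0; apply/eqP; lra.
by move/eqP: D0; apply; rewrite s0; ring.
Qed.

Lemma sc_of_inj (c c' : comm_form R) p q r s :
  in_list c -> in_list c' -> p * s - q * r != 0 ->
  basis_change (sc_of c) (sc_of c') p q r s -> c = c'.
Proof.
move=> inc inc' D0 bc; have [] := trace_change D0 bc.
rewrite -!/(tr1 _) -!/(tr2 _) !tr2_sc_of !mulr0 !addr0 => Ep Eq.
have [t1|t1] : tr1 (sc_of c) = 1 \/ tr1 (sc_of c) = 0.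
- by rewrite tr1_sc_of; case: (c); auto.
- apply: (sc_of_inj_trace1 inc inc' D0 bc t1).
  have : tr1 (sc_of c') = 1 \/ tr1 (sc_of c') = 0.
    by rewrite tr1_sc_of; case: (c'); auto.
  case=> // t1'; rewrite t1 t1' in Ep Eq.
  have p0 : p = 0 by lra.
  have q0 : q = 0 by lra.
  by move/eqP: D0; case; rewrite p0 q0; ring.
rewrite t1 mulr0 in Ep; rewrite !tr1_sc_of in t1 Ep.
case: c c' {inc inc' Eq} t1 Ep bc =>
  [a b|a b|b|a|||||] [a' b'|a' b'|b'|a'|||||] //= t1 Ep bc;
  try by exfalso; lra.
all: try by case: (basis_change_A9_l D0 bc).
all: try by case: (basis_change_A9_r D0 bc).
(* What remains are distinct forms among A6, A7 and A8, with [b] equal to 1, -1 and 0. *)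
all: have := basis_change_sg D0 bc; rewrite ?sgr0 ?sgrN ?sgr1 => E; exfalso; lra.
Qed.

End Uniqueness.

Theorem theorem2p4 (R : realType) (V : vectType R) (mul : {bilinear V -> V -> V}) :
  \dim {:V} = 2%N -> commutative_alg mul -> nontrivial_alg mul ->
  exists! c : comm_form R,
    in_list c /\ isomorphic_alg mul (msc_mul (msc_of c)).
Proof.
move=> dimV mulC nt; have [c [inc rc]] := listed_ex mulC dimV nt.
exists c; split=> [|c' [inc' /(isomorphic_realizes mulC dimV) rc']].
  by split=> //; apply/isomorphic_realizes.
have [p [q [r [s [D0 bc]]]]] := realizes_basis_change mulC dimV rc rc'.
exact: (sc_of_inj inc inc' D0 bc).
Qed.
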